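(* Let $q=p^f$ be a prime power, $N>2$ an integer with $N\mid(q-1)$, $\gamma$ a primitive element of $\mathbb{F}_q$, and $C_0=\langle\gamma^N\rangle$. Let $t$ be the largest power of $p$ dividing $G_q(\chi)$ for all nontrivial multiplicative characters $\chi$ of $\mathbb{F}_q$ trivial on $C_0$. Assume there are positive integers $u,v,r,s$ such that (i) $t(-ur+vs)\equiv -1\pmod N$; (ii) $(N-1)q+t^2(-ur+vs)^2=Nt^2(u^2r+v^2s)$. Let $m=\gcd\{\mathrm{ord}_n(p): n>1,\ n\mid N\}$ and assume $m\ge2$. If one of the following holds: (1) $u=s=1$, $v(v+1)<2m$, and $r+1<N$; (2) $u=s=1$, $v(v+1)=2m$, and $r+v^2<N$; (3) $v=r=1$, $u(u+1)<2m$, and $s+1<N$; (4) $v=r=1$, $u(u+1)=2m$, and $s+u^2<N$; (5) $u=v=1$, $s=m$, and $r+m<N$; (6) $u=v=1$, $r=m$, and $s+m<N$, then the Gauss periods $\eta_a=\sum_{x\in\gamma^aC_0}\psi(x)$, $0\le a\le N-1$, take exactly three values.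
   Context: $\psi$ is the canonical additive character of $\mathbb{F}_q$: $\psi(x)=\xi_p^{\mathrm{Tr}_{q/p}(x)}$. For a multiplicative character $\chi$, $G_q(\chi)=\sum_{a\in\mathbb{F}_q^*}\chi(a)\psi(a)$; divisibility is in the ring of algebraic integers. $\mathrm{ord}_n(p)$ is the multiplicative order of $p$ modulo $n$. *)

(* Defs.v *)
From HB Require Import structures.
From mathcomp Require Import all_boot all_order all_algebra finfield algC algnum.
Set Implicit Arguments. Unset Strict Implicit. Unset Printing Implicit Defensive.
Import GRing.Theory Num.Theory.
Local Open Scope ring_scope.

Section GaussPeriods.
Variables (F : finFieldType) (p f : nat) (xi : algC).

Definition absTr (x : F) : F := \sum_(i < f) x ^+ (p ^ i).

(* The integer k in {0,..,p-1} with k * 1_F = Tr(x) (Tr(x) lies in the prime field). *)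
Definition trace_nat (x : F) : nat :=
  odflt 0%N (omap (@nat_of_ord p) [pick k : 'I_p | (k%:R : F) == absTr x]).

Definition psi (x : F) : algC := xi ^+ trace_nat x.

(* Multiplicative characters: homomorphisms F^* -> C^* (value at 0 irrelevant). *)
Definition is_mul_char (chi : F -> algC) : Prop :=
  chi 1 = 1 /\ forall a b : F, a != 0 -> b != 0 -> chi (a * b) = chi a * chi b.

Definition nontrivial_char (chi : F -> algC) : Prop :=
  exists a : F, a != 0 /\ chi a != 1.

Definition gauss_sum (chi : F -> algC) : algC :=
  \sum_(a : F | a != 0) chi a * psi a.

Definition C0 (gamma : F) (N : nat) : {set F} :=
  [set (gamma ^+ N) ^+ k | k : 'I_#|F|].

Definition cyc_class (gamma : F) (N a : nat) : {set F} :=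
  [set gamma ^+ a * x | x in C0 gamma N].

Definition gauss_period (gamma : F) (N a : nat) : algC :=
  \sum_(x in cyc_class gamma N a) psi x.

End GaussPeriods.

(* ord_n(p): least k >= 1 with p^k = 1 mod n (searched in 1..n, which suffices
   when p is coprime to n, as always below since n | q - 1). *)
Definition ordn (n p : nat) : nat :=
  (find (fun k => p ^ k.+1 == 1 %[mod n]) (iota 0 n)).+1.

Definition gcd_ords (N p : nat) : nat :=
  \big[gcdn/0%N]_(n <- divisors N | (1 < n)%N) ordn n p.

(* Main.v *)
Require Import Defs.
From HB Require Import structures.
From mathcomp Require Import all_boot all_order all_algebra all_fingroup cyclic.
From mathcomp Require Import finfield algC algnum cyclotomic zify ring.
Set Implicit Arguments. Unset Strict Implicit. Unset Printing Implicit Defensive.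
Import Order.TTheory GRing.Theory Num.Theory.
Local Open Scope ring_scope.

(* Since m >= 2, N is coprime to p - 1, so F_p^* lies in C_0 and the periods eta_a are integers.
   By Fourier inversion t divides N eta_a + 1, and (i) lets one write eta_a = t y_a + c with
   integers y_a and c. The autocorrelations of the periods together with (ii) give
   sum y_a = -ur + vs and sum y_a^2 = u^2 r + v^2 s, and t^2 sum y_a (y_a - y_{a+1}) = q.
   The last identity and the maximality of t show that the y_a have no common divisor d > 1.
   Frobenius gives eta_{pa} = eta_a, so each value of y is taken at a multiple of m nonzero
   indices. After replacing y by -y if necessary, sum y_a (y_a + 1) <= 2m in every case; each
   summand is 0 for y_a in {0, -1} and at least 2 otherwise, so either y_0 or one orbit of
   exactly m indices carries the only further value. The two sums then force 0 and -1 both to occur. *)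

(** * Counting the values of an integer function from its first two moments *)

Lemma mulzS_ge0 (z : int) : 0 <= z * (z + 1).
Proof. nia. Qed.

Lemma mulzS_ge2 (z : int) : z != 0 -> z != -1 -> 2 <= z * (z + 1).
Proof.
move=> z0 z1; have [z_ge1|z_le2] : z >= 1 \/ z <= -2 by lia.
  by nia.
by nia.
Qed.

(** A value [z] outside 0 and -1 taken away from [i0] is taken at least [m] times and adds at least
    2 each time, so it exhausts the bound: exactly [m] times, [z * (z + 1) = 2], and every other
    index contributes 0. Failing that, only [i0] can be exceptional, and positivity of the sum makes
    it so. *)
Lemma values_dichotomy (T : finType) (i0 : T) (m : nat) (y : T -> int) :
  (forall z, (m %| #|[set a | (a != i0) && (y a == z)]|)%N) ->
  0 < \sum_a y a * (y a + 1) <= (2 * m)%N%:Z ->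
  exists (z : int) (c : nat),
    [/\ z != 0, z != -1, forall a, [|| y a == 0, y a == -1 | y a == z],
        #|[set a | y a == z]| = c &
        c = 1%N \/ c = m /\ z * (z + 1) = 2].
Proof.
move=> m_dvd /andP[sum_gt0 sum_le].
have h_eq0 (w : int) : w * (w + 1) = 0 -> (w == 0) || (w == -1) by nia.
case: (boolP [exists a, [&& a != i0, y a != 0 & y a != -1]]).
  move=> /existsP[a /and3P[a_i0 ya0 ya1]].
  set z := y a in ya0 ya1.
  pose A := [set b | (b != i0) && (y b == z)].
  have aA : a \in A by rewrite inE a_i0 eqxx.
  have A_gt0 : (0 < #|A|)%N by apply/card_gt0P; exists a.
  have mA : (m <= #|A|)%N.
    by apply: (dvdn_leq A_gt0); apply: m_dvd.
  move: sum_le; rewrite (bigID (mem A)) /=.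
  rewrite (eq_bigr (fun=> z * (z + 1))); last first.
    by move=> b; rewrite inE => /andP[_ /eqP->].
  rewrite sumr_const.
  have rest_ge0 : 0 <= \sum_(b | b \notin A) y b * (y b + 1).
    by apply: sumr_ge0 => b _; apply: mulzS_ge0.
  have z2 := mulzS_ge2 ya0 ya1.
  rewrite -[_ *+ #|A|]mulr_natr natz => sum_le.
  (* The inequality rearranges to [(Z - 2) * k + 2 * (k - m) + R <= 0] with three nonnegative terms,
     so all of them vanish. *)
  have squeeze (k : nat) (Z R : int) : (m <= k)%N -> (0 < k)%N -> 2 <= Z ->
      0 <= R -> Z * k%:Z + R <= (2 * m)%N%:Z -> [/\ R = 0, k = m & Z = 2].
    move=> mk k0 Z2 R0 le2m.
    have : 0 <= (Z - 2) * k%:Z by nia.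
    move=> H; have [R0' km] : R = 0 /\ k = m by split; lia.
    by split=> //; subst; nia.
  have [rest0 cA z2'] := squeeze _ _ _ mA A_gt0 z2 rest_ge0 sum_le.
  have notA b : b \notin A -> (y b == 0) || (y b == -1).
    move=> bA; apply: h_eq0.
    by apply: (psumr_eq0P _ rest0) => // c _; apply: mulzS_ge0.
  (* The index [i0] cannot take the value [z]: it lies outside [A], where only 0 and -1 occur. *)
  have eqA : [set b | y b == z] = A.
    apply/setP => b; rewrite !inE.
    case: eqP => [yb|]; last by rewrite andbF.
    apply/esym/negbNE/negP => /= bA.
    have : b \notin A by rewrite inE yb eqxx.
    by move/notA; rewrite yb (negPf ya0) (negPf ya1).
  exists z, m; split=> //.
  - move=> b; case: (boolP (b \in A)) => [|/notA/orP[]->]; last 2 first.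
    + by [].
    + by rewrite orbT.
    by rewrite inE => /andP[_ ->]; rewrite !orbT.
  - by rewrite eqA.
  - by right.
rewrite negb_exists => /forallP yT.
have yE a : a != i0 -> (y a == 0) || (y a == -1).
  by move=> ai0; have := yT a; rewrite ai0 /= negb_and !negbK.
have yi0 : (y i0 != 0) && (y i0 != -1).
  rewrite -negb_or; apply/negP => yi0; move: sum_gt0.
  rewrite big1 // => a _; have [->|/yE] := eqVneq a i0.
    by case/orP: yi0 => /eqP->.
  by case/orP => /eqP->.
case/andP: yi0 => yi00 yi01.
exists (y i0), 1%N; split => //; last by left.
  move=> a; have [->|/yE] := eqVneq a i0; first by rewrite eqxx !orbT.
  by case/orP => ->; rewrite ?orbT.
rewrite -(cards1 i0); apply: eq_card => a; rewrite !inE.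
have [->|/yE] := eqVneq a i0; first by rewrite eqxx.
by case/orP => /eqP->; rewrite eq_sym; apply: negPf.
Qed.

Lemma size_undup_codom3 (T : finType) (y : T -> int) (z : int) :
  z != 0 -> z != -1 -> (forall a, [|| y a == 0, y a == -1 | y a == z]) ->
  (0 < #|[set a | y a == 0%R]|)%N -> (0 < #|[set a | y a == (-1)%R]|)%N ->
  (0 < #|[set a | y a == z]|)%N ->
  size (undup [seq y a | a : T]) = 3%N.
Proof.
move=> z0 z1 yE /card_gt0P[a0] + /card_gt0P[a1] + /card_gt0P[az].
rewrite !inE => /eqP ya0 /eqP ya1 /eqP yaz.
rewrite -[RHS]/(size [:: 0; -1; z]); apply: perm_size; apply: uniq_perm.
- exact: undup_uniq.
- by rewrite /= !inE !negb_or /= eq_sym z0 eq_sym z1.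
move=> w; rewrite mem_undup !inE; apply/imageP/idP => [[a _ ->]//|].
by case/or3P => /eqP->; [exists a0|exists a1|exists az].
Qed.

(** Three of the six cases suffice: the others follow by applying this to [- y], which exchanges
    [u], [r] with [v], [s]. *)
Lemma three_values (T : finType) (i0 : T) (m u v r s : nat) (y : T -> int) :
  (2 <= m)%N -> (0 < v)%N -> (0 < r)%N ->
  (forall z, (m %| #|[set a | (a != i0) && (y a == z)]|)%N) ->
  (forall d : int, (forall a, (d %| y a)%Z) -> `|d|%N = 1%N) ->
  \sum_a y a = - (u * r)%N%:Z + (v * s)%N%:Z ->
  \sum_a y a ^+ 2 = (u ^ 2 * r)%N%:Z + (v ^ 2 * s)%N%:Z ->
  [\/ [/\ u = 1%N, s = 1%N, (v * (v + 1) < 2 * m)%N & (r + 1 < #|T|)%N],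
      [/\ u = 1%N, s = 1%N, (v * (v + 1) = 2 * m)%N & (r + v ^ 2 < #|T|)%N] |
      [/\ u = 1%N, v = 1%N, s = m & (r + m < #|T|)%N] ] ->
  size (undup [seq y a | a : T]) = 3%N.
Proof.
move=> m2 v0 r0 m_dvd y_prim sumy sumy2 cases.
have sumyy : \sum_a y a * (y a + 1) =
    (u ^ 2 * r)%N%:Z + (v ^ 2 * s)%N%:Z - (u * r)%N%:Z + (v * s)%N%:Z.
  rewrite -addrA -sumy -sumy2 -big_split; apply: eq_bigr => a _ /=; ring.
(* As [u = 1], the sum is [v * (v + 1) * s], which is at most [2 * m] in all three cases. *)
have sum_bounds : 0 < \sum_a y a * (y a + 1) <= (2 * m)%N%:Z.
  by rewrite sumyy; case: cases => -[-> -> ? ?]; nia.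
have [z [c [z0 z1 yE cz c_case]]] := values_dichotomy m_dvd sum_bounds.
pose n0 := #|[set a | y a == 0]|; pose n1 := #|[set a | y a == -1]|.
have mulrn_int (w : int) (n : nat) : w *+ n = w * n%:Z.
  by rewrite -mulr_natr natz.
(* Applied to 1, to the identity and to [w * (w + 1)], this gives three linear equations in [n0],
   [n1] and [c]. *)
have sum_by_value (g : int -> int) :
    \sum_a g (y a) = g 0 * n0%:Z + g (-1) * n1%:Z + g z * c%:Z.
  rewrite -!mulrn_int (bigID (fun a => y a == 0)) -addrA; congr (_ + _).
    by rewrite /n0 -sumr_const; apply: eq_big => a; rewrite ?inE // => /eqP->.
  rewrite (bigID (fun a => y a == -1)); congr (_ + _).
    rewrite /n1 -sumr_const; apply: eq_big => a; rewrite ?inE.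
      by case: eqP => [->|_] //; case: eqP => // ->.
    by case/andP => _ /eqP->.
  rewrite -cz -sumr_const; apply: eq_big => a; rewrite ?inE.
    have := yE a; case: (y a =P 0) => [->|_ /=].
      by rewrite (eq_sym _ z) (negPf z0).
    by case: (y a =P -1) => [->|_ /= ->] //; rewrite (eq_sym _ z) (negPf z1).
  by move=> /andP[ya0 ya1]; have := yE a; rewrite (negPf ya0) (negPf ya1) => /eqP->.
have count : #|T| = (n0 + n1 + c)%N.
  have := sum_by_value (fun=> 1); rewrite sumr_const mulrn_int -[#|xpredT|]/#|T|.
  by lia.
have S_eq : z * c%:Z - n1%:Z = - (u * r)%N%:Z + (v * s)%N%:Z.
  by rewrite -sumy (sum_by_value id); lia.
have M_eq : z * (z + 1) * c%:Z =
    (u ^ 2 * r)%N%:Z + (v ^ 2 * s)%N%:Z - (u * r)%N%:Z + (v * s)%N%:Z.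
  by rewrite -sumyy (sum_by_value (fun w => w * (w + 1))); lia.
(* Without the value -1, z divides every y a. *)
have n1_z : n1 = 0%N -> z = 1.
  move=> n1_0; suff : `|z|%N = 1%N by lia.
  apply: y_prim => a; have := yE a; case/or3P => /eqP ya.
  - by rewrite ya dvdz0.
  - have : (0 < n1)%N by apply/card_gt0P; exists a; rewrite inE ya.
    by rewrite n1_0.
  - by rewrite ya dvdzz.
have c_gt0 : (0 < c)%N by case: c_case => [->|[-> _]]; lia.
have z_cases : z * (z + 1) = 2 -> z = 1 \/ z = -2.
  by move=> zz; have : (z - 1) * (z + 2) = 0; [lia|nia].
have zv_cases : z * (z + 1) = v%:Z * (v%:Z + 1) -> z = v \/ z = - v%:Z - 1.
  by move=> zz; have : (z - v%:Z) * (z + v%:Z + 1) = 0; [lia|nia].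
have v_le : (v <= v ^ 2)%N by nia.
have z_le : z + 1 <= z * (z + 1).
  by have [z_ge1|z_le2] : z >= 1 \/ z <= -2; [lia|nia|nia].
(* The first moment fixes [n1], and then [n0 = #|T| - n1 - c]. The bounds on [r] keep [n0] positive:
   in the second case with [c = m] and [z = 1], for instance, [n0 = #|T| - r - v ^ 2]. For negative
   [z], [n1P] gives [n1 > 0] at once. *)
have [n0_gt0 n1_gt0] : (0 < n0)%N /\ (0 < n1)%N.
  have n1P : (0 < n1)%N \/ z = 1 by case: (posnP n1) => [/n1_z|]; [right|left].
  clear -m2 v0 r0 count S_eq M_eq n1P c_case cases z_cases zv_cases v_le z_le.
  case: c_case => [c1|[cm zz2]]; first subst c.
    case: cases => -[Hu Hs Hm Hr]; subst u.
    - by subst s; case: zv_cases; [lia|lia|lia].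
    - by subst s; case: zv_cases; [lia|lia|lia].
    - subst v s; clear zv_cases z_cases; split; first lia.
      by case: n1P => // z1; rewrite z1 in M_eq; lia.
  rewrite zz2 in M_eq z_le; move: (z_cases zz2) => {z_cases zv_cases zz2} z12.
  subst c; case: cases => -[Hu Hs Hm Hr]; subst u.
  - by subst s; lia.
  - by subst s; case: z12 => z_eq; rewrite z_eq in S_eq n1P; lia.
  - by subst v s; case: z12 => z_eq; rewrite z_eq in S_eq n1P; lia.
by apply: (size_undup_codom3 z0 z1 yE) => //; rewrite cz.
Qed.

(** * Multiplicative orders, and orbits of multiplication by [p] modulo [N] *)

Lemma expn_ordn (n p : nat) :
  (1 < n)%N -> coprime p n -> p ^ ordn n p = 1 %[mod n].
Proof.
move=> n_gt1 co_pn; rewrite /ordn.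
pose P k := p ^ k.+1 == 1 %[mod n].
have has_ord : has P (iota 0 n).
  (* Euler's exponent [totient n] is at most [n], so the bounded search succeeds; the predecessor
     appears because [ordn] tests [k.+1]. *)
  apply/hasP; exists (totient n).-1.
    rewrite mem_iota add0n /= prednK ?totient_gt0 ?(ltnW n_gt1) //.
    rewrite totient_count_coprime.
    apply: (@leq_trans (\sum_(0 <= d < n) 1)%N).
      by apply: leq_sum => d _; apply: leq_b1.
    by rewrite sum_nat_const_nat subn0 muln1.
  rewrite /P prednK ?totient_gt0 ?(ltnW n_gt1) //.
  by apply/eqP; apply: Euler_exp_totient.
have := nth_find 0%N has_ord; rewrite nth_iota; first by move=> /eqP.
by rewrite -{2}(size_iota 0 n) -has_find.
Qed.

Lemma ordn_dvd (n p k : nat) :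
  (1 < n)%N -> coprime p n -> p ^ k = 1 %[mod n] -> (ordn n p %| k)%N.
Proof.
move=> n_gt1 co_pn pk1; apply: contraT => ndvd.
have o_gt0 : (0 < ordn n p)%N by [].
have p1 : p ^ (k %% ordn n p) = 1 %[mod n].
  rewrite -{}pk1 {2}(divn_eq k (ordn n p)) expnD.
  rewrite (mulnC (k %/ _)%N) expnM -modnMml -(modnXm (k %/ _)) expn_ordn //.
  by rewrite modnXm exp1n modnMml mul1n.
have r_gt0 : (0 < k %% ordn n p)%N by rewrite lt0n.
have r_lt : ((k %% ordn n p).-1 < (ordn n p).-1)%N.
  by rewrite -ltnS !prednK // ltn_mod.
have lt_n : ((k %% ordn n p).-1 < n)%N.
  apply: leq_trans r_lt _; rewrite /ordn /=.
  by rewrite -[leqRHS](size_iota 0 n); apply: find_size.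
have := before_find 0%N r_lt.
by rewrite nth_iota // add0n prednK // p1 eqxx.
Qed.

Lemma gcd_ords_dvd (N p n : nat) :
  (0 < N)%N -> (n %| N)%N -> (1 < n)%N -> (gcd_ords N p %| ordn n p)%N.
Proof.
move=> N0 nN n_gt1; rewrite /gcd_ords (big_rem n) -?dvdn_divisors //= n_gt1.
exact: dvdn_gcdl.
Qed.

(** Modulo a common divisor [g > 1] of [p - 1] and [N], [p] is 1 and has order 1, which would force
    the gcd of the orders to be 1. *)
Lemma gcd_ords_coprime (N p : nat) :
  (0 < N)%N -> (0 < p)%N -> (1 < gcd_ords N p)%N -> coprime p.-1 N.
Proof.
move=> N0 p0 m_gt1; apply: contraLR m_gt1 => nco; rewrite -leqNgt.
have g_gt1 : (1 < gcdn p.-1 N)%N.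
  by rewrite ltn_neqAle eq_sym nco gcdn_gt0 N0 orbT.
have := gcd_ords_dvd p N0 (dvdn_gcdr p.-1 N) g_gt1.
suff -> : ordn (gcdn p.-1 N) p = 1%N by rewrite dvdn1 => /eqP->.
rewrite /ordn; case: (gcdn p.-1 N) (dvdn_gcdl p.-1 N) => //= n n_dvd.
by rewrite expn1 eqn_mod_dvd // subn1 n_dvd.
Qed.

(* The orbit of a <> 0 under multiplication by p on Z/N has length ord_n(p), n = N / gcd(a,N). *)
Lemma gcd_ords_dvd_card (N p : nat) (A : {set 'I_N}) :
  coprime p N -> (forall a, a \in A -> a != 0%N :> nat) ->
  (forall a b : 'I_N, b = p * a %[mod N] -> a \in A -> b \in A) ->
  (gcd_ords N p %| #|A|)%N.
Proof.
case: N A => [|N] A co_pN A0 pA.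
  by rewrite (eq_card0 (A := mem A)) ?dvdn0 // => -[].
pose h (a : 'I_N.+1) : 'I_N.+1 := inord (p * a %% N.+1)%N.
have hE a : h a = (p * a %% N.+1)%N :> nat by rewrite inordK // ltn_mod.
have h_inj : injective h.
  move=> a b /(congr1 val) /=; rewrite !hE => /eqP.
  have [le_ba|lt_ab] := leqP b a; last first.
    rewrite eq_sym eqn_mod_dvd ?leq_mul2l ?(ltnW lt_ab) ?orbT //.
    rewrite -mulnBr Gauss_dvdr 1?coprime_sym // -eqn_mod_dvd ?(ltnW lt_ab) //.
    by rewrite !modn_small // => /eqP eq_ab; apply: val_inj.
  rewrite eqn_mod_dvd ?leq_mul2l ?le_ba ?orbT //.
  rewrite -mulnBr Gauss_dvdr 1?coprime_sym // -eqn_mod_dvd //.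
  by rewrite !modn_small // => /eqP eq_ab; apply: val_inj.
pose s := perm h_inj.
have iterE k a : iter k s a = (p ^ k * a %% N.+1)%N :> nat.
  elim: k => [|k IHk]; first by rewrite mul1n modn_small.
  by rewrite iterS permE hE IHk modnMmr mulnA expnS.
have sA k a : a \in A -> (s ^+ k)%g a \in A.
  move=> aA; rewrite permX; elim: k => [|k IHk] //=.
  by rewrite permE; apply: pA IHk; rewrite hE modn_mod.
(* [A] is a union of orbits of [s], so it suffices to treat a single orbit. *)
rewrite (card_partition (preim_partitionP (porbit s) A)).
apply: dvdn_sum => B /imsetP[a aA ->{B}].
have -> : [set b in A | porbit s a == porbit s b] = porbit s a.
  apply/setP => b; rewrite inE eq_porbit_mem porbit_sym andb_idl //.
  by case/porbitP => k ->; apply: sA.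
have a_gt0 : (0 < a)%N by rewrite lt0n A0.
pose g := gcdn a N.+1.
have g_gt0 : (0 < g)%N by rewrite gcdn_gt0 a_gt0.
have gN : (g %| N.+1)%N := dvdn_gcdr _ _.
have ga : (g %| a)%N := dvdn_gcdl _ _.
pose n := (N.+1 %/ g)%N.
have nN : (n * g)%N = N.+1 by rewrite divnK.
have n_gt1 : (1 < n)%N.
  rewrite -(ltn_pmul2r g_gt0) nN mul1n.
  by apply: leq_ltn_trans (dvdn_leq a_gt0 ga) _.
have co_pn : coprime p n by apply: coprime_dvdr co_pN; rewrite -nN dvdn_mulr.
apply: (@dvdn_trans (ordn n p)).
  by apply: gcd_ords_dvd; rewrite // -nN dvdn_mulr.
(* The orbit length [k] satisfies [p ^ k * a = a] modulo [N]; cancelling [g], and then [a %/ g],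
   which is a unit modulo [n], leaves [p ^ k = 1] modulo [n]. *)
set k := #|_|; apply: ordn_dvd => //.
have /(congr1 val) := iter_porbit s a; rewrite -/k /= iterE => /eqP.
rewrite -{2}(modn_small (ltn_ord a)) -{2}[val a]mul1n.
have p0 : (0 < p)%N.
  rewrite lt0n; apply: contraL co_pn => /eqP->.
  by rewrite /coprime gcd0n gtn_eqF.
have pk : (1 <= p ^ k)%N by rewrite expn_gt0 p0.
rewrite eqn_mod_dvd; last by rewrite leq_mul2r pk orbT.
rewrite -mulnBl -{1}nN.
have -> : ((p ^ k - 1) * val a = (p ^ k - 1) * (a %/ g) * g)%N.
  by rewrite -mulnA divnK.
rewrite dvdn_pmul2r //.
rewrite Gauss_dvdl; last first.
  rewrite coprime_sym; rewrite /coprime -(eqn_pmul2r g_gt0) muln_gcdl divnK //.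
  by rewrite nN mul1n.
by rewrite -eqn_mod_dvd // => /eqP.
Qed.

(** * The absolute trace and the canonical additive character *)

Section AdditiveCharacter.

Variables (F : finFieldType) (p f : nat) (xi : algC).
Hypotheses (pF : p \in [pchar F]) (cardF : #|F| = (p ^ f)%N).
Hypothesis xi_prim : p.-primitive_root xi.

Local Notation Tr := (@absTr F p f).
Local Notation psi := (@psi F p f xi).

Let p_prime : prime p := pcharf_prime pF.

Lemma f_gt0 : (0 < f)%N.
Proof.
by case: f cardF (finNzRing_gt1 F) => // ->; rewrite expn0.
Qed.

Lemma frobeniusD i (x y : F) : (x + y) ^+ (p ^ i) = x ^+ (p ^ i) + y ^+ (p ^ i).
Proof. by apply: exprDn_pchar; rewrite pnatX pnatE ?pF. Qed.

Lemma frobenius_nat i c : (c%:R : F) ^+ (p ^ i) = c%:R.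
Proof.
elim: i => [|i IHi]; first by rewrite expr1.
by rewrite expnSr exprM IHi -(pFrobenius_autE pF) pFrobenius_aut_nat.
Qed.

Lemma absTrD x y : Tr (x + y) = Tr x + Tr y.
Proof. by rewrite -big_split; apply: eq_bigr => i _; apply: frobeniusD. Qed.

Lemma absTrM_nat c x : Tr (c%:R * x) = c%:R * Tr x.
Proof.
by rewrite mulr_sumr; apply: eq_bigr => i _; rewrite exprMn frobenius_nat.
Qed.

Lemma absTr_frobenius x : Tr (x ^+ p) = Tr x.
Proof.
rewrite /absTr; case: f f_gt0 cardF => // n _ cF.
rewrite big_ord_recr [RHS]big_ord_recl /= -exprM -expnS -cF expf_card addrC.
by congr (_ + _); apply: eq_bigr => i _; rewrite -exprM -expnS.
Qed.

Lemma absTrX x : Tr x ^+ p = Tr x.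
Proof.
rewrite -{2}absTr_frobenius /absTr -(pFrobenius_autE pF) rmorph_sum.
by apply: eq_bigr => i _; rewrite /= pFrobenius_autE -!exprM mulnC.
Qed.

Lemma eqr_nat_mod i j : ((i%:R : F) == j%:R) = (i == j %[mod p])%N.
Proof.
wlog le_ji : i j / (j <= i)%N => [IH|].
  by have [/IH//|/ltnW/IH] := leqP j i; rewrite eq_sym => ->; rewrite eq_sym.
by rewrite eqn_mod_dvd // (dvdn_pcharf pF) natrB // subr_eq0.
Qed.

(** The polynomial ['X^p - 'X] already has the [p] multiples of 1 as roots, so there is no room for
    another one. *)
Lemma prime_subfield (z : F) : z ^+ p = z -> exists k : 'I_p, k%:R = z.
Proof.
move=> zp; case: (pickP (fun k : 'I_p => k%:R == z)) => [k /eqP|z_notin].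
  by exists k.
pose P : {poly F} := 'X^p - 'X.
have szP : size P = p.+1.
  by rewrite size_polyDl size_polyXn // size_polyN size_polyX ltnS prime_gt1.
have P0 : P != 0 by rewrite -size_poly_eq0 szP.
have rootP w : w ^+ p = w -> root P w.
  by move=> wp; rewrite rootE !hornerE wp subrr.
pose rs := z :: [seq (k : nat)%:R | k : 'I_p].
have := @max_poly_roots _ P rs P0; rewrite szP /= size_map size_enum_ord ltnn.
case/(_ _ _)/notF.
  rewrite rootP //=; apply/allP => w /mapP[k _ ->]; apply: rootP.
  exact: (frobenius_nat 1).
apply/andP; split; first by apply/mapP => -[k _ zk]; have := z_notin k; rewrite zk eqxx.
rewrite map_inj_uniq ?enum_uniq // => i j /eqP; rewrite eqr_nat_mod.
by rewrite !modn_small // => /eqP /val_inj.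
Qed.

(** The default value 0 in [trace_nat] is never reached, since the trace is fixed by Frobenius and
    so lies in the prime field. *)
Lemma trace_natE x : (trace_nat p f x)%:R = Tr x.
Proof.
rewrite /trace_nat; case: pickP => [k /eqP //|none] /=.
by have [k Ek] := prime_subfield (absTrX x); have := none k; rewrite Ek eqxx.
Qed.

Lemma psiE x k : k%:R = Tr x -> psi x = xi ^+ k.
Proof.
rewrite -trace_natE => /eqP; rewrite eqr_nat_mod => /eqP eq_k; apply/eqP.
by rewrite (eq_prim_root_expr xi_prim) eq_k.
Qed.

Lemma psiD x y : psi (x + y) = psi x * psi y.
Proof.
by rewrite -exprD; apply: psiE; rewrite natrD !trace_natE absTrD.
Qed.

Lemma psiM_nat c x : psi (c%:R * x) = psi x ^+ c.
Proof.
by rewrite -exprM; apply: psiE; rewrite mulnC natrM trace_natE absTrM_nat.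
Qed.

Lemma psi0 : psi 0 = 1.
Proof. by rewrite -(mul0r 0) (psiM_nat 0). Qed.

Lemma psi_frobenius x : psi (x ^+ p) = psi x.
Proof. by apply: psiE; rewrite absTr_frobenius trace_natE. Qed.

Lemma psi_Aint x : psi x \in Aint.
Proof. by rewrite rpredX // (Aint_prim_root xi_prim). Qed.

Lemma psiXp x : psi x ^+ p = 1.
Proof. by rewrite -psiM_nat (pcharf0 pF) mul0r psi0. Qed.

(** The trace is a polynomial of degree below [#|F|] whose coefficient of ['X] is 1, so it cannot
    vanish on all of [F]. *)
Lemma psi_nontrivial : exists x, psi x != 1.
Proof.
pose P : {poly F} := \sum_(i < f) 'X^(p ^ i).
have P0 : P != 0.
  apply/eqP => /(congr1 (fun Q : {poly F} => Q`_1)).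
  rewrite coef0 coef_sum (bigD1 (Ordinal f_gt0)) //= coefXn big1 ?addr0.
    by move/eqP; rewrite oner_eq0.
  move=> i /negPf i0; rewrite coefXn eq_sym -[1%N](expn0 p) eqn_exp2l ?prime_gt1 //.
  by move: i0; rewrite -val_eqE /= => ->.
have szP : (size P <= #|F|)%N.
  apply: leq_trans (size_sum _ _ _) _; apply/bigmax_leqP => i _.
  by rewrite size_polyXn cardF ltn_exp2l ?prime_gt1.
have [x Px] : exists x, ~~ root P x.
  apply/existsP; apply: contraLR szP; rewrite negb_exists -ltnNge => /forallP allr.
  rewrite cardE; apply: max_poly_roots => //; last exact: enum_uniq.
  by apply/allP => x _; have := allr x; rewrite negbK.
exists x; apply: contra Px => /eqP psi1.
have : xi ^+ trace_nat p f x == xi ^+ 0 by rewrite expr0 -psi1.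
rewrite (eq_prim_root_expr xi_prim) -eqr_nat_mod trace_natE => /eqP Tr0.
have Px : P.[x] = Tr x.
  by rewrite horner_sum; apply: eq_bigr => i _; rewrite hornerXn.
by rewrite rootE Px Tr0.
Qed.

Lemma sum_psi (b : F) : \sum_x psi (x * b) = (if b == 0 then #|F| else 0)%:R.
Proof.
case: eqP => [->|/eqP b0].
  by under eq_bigr do rewrite mulr0 psi0; rewrite sumr_const.
rewrite -(reindex_inj (mulIf b0) (P := xpredT) (F := psi)).
have [x0 px0] := psi_nontrivial.
have : \sum_x psi x = psi x0 * \sum_x psi x.
  rewrite mulr_sumr [LHS](reindex_inj (addrI x0)).
  by apply: eq_bigr => x _; rewrite psiD.
move/eqP; rewrite -subr_eq0 -{1}[\sum_x _]mul1r -mulrBl mulf_eq0 subr_eq0.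
by rewrite eq_sym (negPf px0) /= => /eqP.
Qed.

(** * Cyclotomic classes and Gauss periods *)

Variables (gamma : F) (N : nat).
Hypotheses (N_gt2 : (2 < N)%N) (N_dvd : (N %| #|F| - 1)%N).
Hypothesis gamma_prim : (#|F| - 1)%N.-primitive_root gamma.

Local Notation C a := (cyc_class gamma N a).
Local Notation eta a := (gauss_period p f xi gamma N a).

Let N_gt0 : (0 < N)%N := ltnW (ltnW N_gt2).

Lemma coprime_char_N : coprime p N.
Proof.
rewrite (coprime_dvdr N_dvd) // -(coprime_pexpl _ _ f_gt0) -cardF subn1.
by rewrite -{1}(prednK (ltnW (finNzRing_gt1 F))) coprimeSn.
Qed.

Lemma gamma_neq0 : gamma != 0.
Proof.
by rewrite (prim_root_eq0 gamma_prim) -lt0n; apply: prim_order_gt0 gamma_prim.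
Qed.

Lemma exp_gammaP (x : F) : x != 0 -> exists l, x = gamma ^+ l.
Proof.
move=> x0; have x1 : x ^+ (#|F| - 1) = 1.
  apply: (mulfI x0); rewrite mulr1 -exprS subn1 prednK ?expf_card //.
  exact: ltnW (finNzRing_gt1 F).
by have [l ->] := prim_rootP gamma_prim x1; exists l.
Qed.

Lemma cyc_classP a x : reflect (exists k, x = gamma ^+ (a + N * k)) (x \in C a).
Proof.
apply: (iffP imsetP) => [[_ /imsetP[k _ ->] ->]|[k ->]].
  by exists k; rewrite exprD exprM.
exists (gamma ^+ (N * k)); last by rewrite exprD.
(* [C0] only lists exponents below [#|F|], so [k] is reduced modulo the order of [gamma]. *)
have lt_k : (k %% (#|F| - 1) < #|F|)%N.
  apply: leq_trans (ltn_pmod _ (prim_order_gt0 gamma_prim)) _.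
  by rewrite subn1 leq_pred.
apply/imsetP; exists (Ordinal lt_k) => //=.
rewrite -exprM; apply/eqP; rewrite (eq_prim_root_expr gamma_prim).
by rewrite modnMmr.
Qed.

Lemma exp_gamma_class a l : (gamma ^+ l \in C a) = (l == a %[mod N])%N.
Proof.
apply/cyc_classP/eqP => [[k /eqP]|la].
  rewrite (eq_prim_root_expr gamma_prim) => /eqP /(congr1 (modn^~ N)).
  by rewrite !modn_dvdm // addnC mulnC modnMDl.
have q1 := prim_order_gt0 gamma_prim.
have /dvdnP[n q1E] := N_dvd.
have n_gt0 : (0 < n)%N by move: q1; rewrite q1E muln_gt0 => /andP[].
(* The number [l + a * (n * N - 1)] stands for [l - a] modulo [n * N = #|F| - 1] and avoids
   truncated subtraction. *)
exists ((l + a * (n * N - 1)) %/ N)%N; apply/eqP.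
have nN_gt0 : (0 < n * N)%N by rewrite muln_gt0 n_gt0.
rewrite (eq_prim_root_expr gamma_prim) q1E [(N * (_ %/ _))%N]mulnC divnK; last first.
  rewrite /dvdn -modnDml la modnDml -{1}[a]muln1 -mulnDr subnKC //.
  by rewrite mulnA modnMl.
by rewrite addnCA -{1}[a]muln1 -mulnDr subnKC // addnC modnMDl.
Qed.

Lemma cyc_class_neq0 a x : x \in C a -> x != 0.
Proof. by case/cyc_classP => k ->; rewrite expf_neq0 ?gamma_neq0. Qed.

Lemma cyc_class_mod a b : a = b %[mod N] -> C a = C b.
Proof.
move=> ab; apply/setP => x; have [->|/exp_gammaP[l ->]] := eqVneq x 0.
  by apply/idP/idP => /cyc_class_neq0; rewrite eqxx.
by rewrite !exp_gamma_class ab.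
Qed.

Lemma cyc_classM a b x z :
  x \in C a -> (x * z \in C (a + b)) = (z \in C b).
Proof.
have [->|/exp_gammaP[j ->]] := eqVneq z 0.
  by rewrite mulr0 => _; apply/idP/idP => /cyc_class_neq0; rewrite eqxx.
move=> xa; have /exp_gammaP[i xE] := cyc_class_neq0 xa.
move: xa; rewrite xE -exprD !exp_gamma_class => /eqP ia.
by rewrite -modnDml ia modnDml eqn_modDl.
Qed.

Lemma big_cyc_classM (R : nmodType) a b x (g : F -> R) :
  x \in C a -> \sum_(y in C (a + b)) g y = \sum_(z in C b) g (x * z).
Proof.
move=> xa; have x0 := cyc_class_neq0 xa.
rewrite (reindex_inj (mulfI x0)); apply: eq_bigl => z.
exact: cyc_classM.
Qed.

Lemma big_cyc_classes (R : nmodType) (g : F -> R) :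
  \sum_(a < N) \sum_(x in C a) g x = \sum_(x | x != 0) g x.
Proof.
rewrite (exchange_big_dep [pred x | x != 0]) /=; last first.
  by move=> a x _; apply: cyc_class_neq0.
apply: eq_bigr => x /exp_gammaP[l ->].
rewrite (big_pred1 (Ordinal (ltn_pmod l N_gt0))) // => a.
by rewrite exp_gamma_class /= -val_eqE /= (modn_small (ltn_ord a)) eq_sym.
Qed.

Lemma card_cyc_class a b : #|C a| = #|C b|.
Proof.
suff card0 c : #|C c| = #|C 0| by rewrite !card0.
have cC : gamma ^+ c \in C c by rewrite exp_gamma_class.
by rewrite -!sum1_card -[c in LHS]addn0 (big_cyc_classM _ _ cC).
Qed.

Lemma card_cyc_class0 : (N * #|C 0|)%N = (#|F| - 1)%N.
Proof.
have := big_cyc_classes (fun=> 1%N); rewrite sum1_card.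
have -> : #|[pred x : F | x != 0]| = (#|F| - 1)%N.
  by rewrite subn1 -(cardC1 (0 : F)); apply: eq_card.
move=> <-; under eq_bigr do rewrite sum1_card (card_cyc_class _ 0).
by rewrite sum_nat_const card_ord.
Qed.

Lemma gauss_period_mod a b : a = b %[mod N] -> eta a = eta b.
Proof. by move=> ab; rewrite /gauss_period (cyc_class_mod ab). Qed.

(** Frobenius maps the class of [a] onto that of [p * a], by inclusion and equal cardinality, and it
    preserves [psi]. *)
Lemma gauss_period_frobenius a : eta (p * a)%N = eta a.
Proof.
have frob_inj : injective (fun x : F => x ^+ p).
  by move=> x y; apply: (fmorph_inj (pFrobenius_aut pF)).
have sub : [set x ^+ p | x in C a] \subset C (p * a)%N.
  apply/subsetP => _ /imsetP[x /cyc_classP[k ->] ->]; apply/cyc_classP.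
  by exists (p * k)%N; rewrite -exprM mulnC mulnDr mulnCA.
have eqC : C (p * a)%N = [set x ^+ p | x in C a].
  apply/esym/eqP; rewrite eqEcard sub (card_imset _ frob_inj).
  by rewrite (card_cyc_class (p * a)%N a) leqnn.
rewrite /gauss_period eqC big_imset /=; last by move=> x y _ _; apply: frob_inj.
by apply: eq_bigr => x _; apply: psi_frobenius.
Qed.

Lemma sum_gauss_period : \sum_(a < N) eta a = -1.
Proof.
rewrite (big_cyc_classes (fun x => psi x)).
have := sum_psi 1; rewrite oner_eq0 (bigD1 0) //= mulr1 psi0.
under eq_bigr do rewrite mulr1.
by move/eqP; rewrite addrC addr_eq0 => /eqP.
Qed.

Lemma gauss_period_Aint a : eta a \in Aint.
Proof. by rewrite rpred_sum // => x _; apply: psi_Aint. Qed.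

(** * Integrality and autocorrelation of the periods *)

Section RationalPeriods.

Hypothesis co_p1N : coprime p.-1 N.

(** Writing [c = gamma ^+ l], Fermat's [c ^+ p.-1 = 1] makes [N] divide [p.-1 * l], hence [l]. *)
Lemma prime_subfield_C0 c : (c%:R : F) != 0 -> c%:R \in C 0.
Proof.
move=> c0; have [l cl] := exp_gammaP c0.
rewrite cl exp_gamma_class mod0n -/(dvdn N l) -(Gauss_dvdr _ (n := p.-1)); last first.
  by rewrite coprime_sym.
apply: dvdn_trans N_dvd _; rewrite (prim_order_dvd gamma_prim) mulnC exprM -cl.
apply/eqP/(mulfI c0); rewrite mulr1 -exprS prednK ?prime_gt0 //.
exact: (frobenius_nat 1).
Qed.

Lemma gauss_periodM_nat c a :
  (c%:R : F) != 0 -> eta a = \sum_(x in C a) psi x ^+ c.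
Proof.
move=> c0; rewrite /gauss_period -{1}[a]add0n.
rewrite (big_cyc_classM _ _ (prime_subfield_C0 c0)).
by apply: eq_bigr => x _; apply: psiM_nat.
Qed.

(** Summing [psi x ^+ c] over [c < p] gives [p] or 0. The terms with [c > 0] all sum to [eta a] over
    the class, so [p.-1 * eta a] is an integer; thus [eta a] is a rational algebraic integer. *)
Lemma gauss_period_int a : eta a \in Num.int.
Proof.
apply: Cint_rat_Aint (gauss_period_Aint a).
have sum_int : \sum_(c < p) \sum_(x in C a) psi x ^+ c \in Num.int.
  rewrite exchange_big rpred_sum // => x _ /=.
  have [->|px] := eqVneq (psi x) 1.
    by apply: rpred_sum => c _; rewrite expr1n rpred1.
  have := subrX1 (psi x) p; rewrite psiXp subrr => /esym/eqP.
  by rewrite mulf_eq0 subr_eq0 (negPf px) => /eqP->; apply: rpred0.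
have sumE : \sum_(c < p) \sum_(x in C a) psi x ^+ c = #|C a|%:R + (p.-1)%:R * eta a.
  rewrite -(big_mkord xpredT (fun c => \sum_(x in C a) psi x ^+ c)).
  rewrite big_ltn ?prime_gt0 //; congr (_ + _).
    by under eq_bigr do rewrite expr0; rewrite sumr_const.
  rewrite (eq_big_nat _ _ (F2 := fun=> eta a)).
    by rewrite sumr_const_nat subn1 mulr_natl.
  move=> c /andP[c_gt0 c_lt]; apply/esym/gauss_periodM_nat.
  by rewrite -(dvdn_pcharf pF) gtnNdvd.
have p1_neq0 : (p.-1)%:R != 0 :> algC.
  by rewrite pnatr_eq0 -lt0n -ltnS prednK ?prime_gt0 ?prime_gt1.
have -> : eta a = (\sum_(c < p) \sum_(x in C a) psi x ^+ c - #|C a|%:R) / (p.-1)%:R.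
  by rewrite sumE addrC addrA addNr add0r mulrC mulKf.
by rewrite rpred_div ?rpredB ?rpred_nat // rpred_int_num.
Qed.

Lemma gauss_period_correlation b :
  \sum_(a < N) eta a * eta (a + b) =
    (if (N %| b)%N then #|F| else 0)%:R - #|C 0|%:R.
Proof.
(* Since -1 lies in the prime field, hence in [C 0], the second factor may be conjugated.
   Substituting [y = x * z] then turns the product into [psi (x * (1 - z))], whose sum over nonzero
   [x] is -1 unless [z = 1]. *)
have etaN c : eta c = \sum_(y in C c) psi (- y).
  have m1 : - (1 : F) = (p.-1)%:R.
    by apply/esym/eqP; rewrite -addr_eq0 natr1 prednK ?prime_gt0 // (pcharf0 pF).
  have m1_neq0 : ((p.-1)%:R : F) != 0 by rewrite -m1 oppr_eq0 oner_eq0.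
  rewrite (gauss_periodM_nat _ m1_neq0); apply: eq_bigr => y _.
  by rewrite -psiM_nat -m1 mulN1r.
transitivity (\sum_(a < N) \sum_(x in C a) \sum_(z in C b) psi (x * (1 - z))).
  apply: eq_bigr => a _; rewrite (etaN (a + b)%N) mulr_suml; apply: eq_bigr => x xa.
  rewrite (big_cyc_classM _ _ xa) mulr_sumr; apply: eq_bigr => z _.
  by rewrite -psiD mulrBr mulr1.
rewrite (big_cyc_classes (fun x => \sum_(z in C b) psi (x * (1 - z)))) exchange_big /=.
transitivity (\sum_(z in C b) ((if z == 1 then #|F| else 0)%:R - 1 : algC)).
  apply: eq_bigr => z _; have := sum_psi (1 - z).
  rewrite subr_eq0 eq_sym (bigD1 0) //= mul0r psi0 => <-.
  by rewrite addrAC subrr add0r.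
rewrite big_split /= sumrN sumr_const (card_cyc_class b 0); congr (_ - _).
have C1 : (1 \in C b) = (N %| b)%N.
  by rewrite -[1](expr0 gamma) exp_gamma_class mod0n eq_sym.
case: ifP => Nb; rewrite Nb in C1.
  rewrite (bigD1 1) //= eqxx big1 ?addr0 // => z /andP[_ /negPf->].
  by [].
by apply: big1 => z zb; case: eqP => // z1; rewrite -z1 zb in C1.
Qed.

End RationalPeriods.

(** * Multiplicative characters trivial on [C0] and Fourier inversion *)

Section MultiplicativeCharacters.

Lemma mul_char_exp (chi : F -> algC) l :
  is_mul_char chi -> chi (gamma ^+ l) = chi gamma ^+ l.
Proof.
case=> chi1 chiM; elim: l => // l IHl.
by rewrite !exprS chiM ?IHl ?expf_neq0 ?gamma_neq0.
Qed.

Section TrivialOnC0.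

Variable chi : F -> algC.
Hypotheses (chi_mul : is_mul_char chi) (chi_C0 : forall x, x \in C0 gamma N -> chi x = 1).

Lemma mul_char_unity_root : chi gamma ^+ N = 1.
Proof.
rewrite -mul_char_exp // chi_C0 //; apply/imsetP.
by exists (Ordinal (finNzRing_gt1 F)).
Qed.

Lemma gauss_sum_periods :
  gauss_sum p f xi chi = \sum_(a < N) chi gamma ^+ a * eta a.
Proof.
rewrite /gauss_sum -(big_cyc_classes (fun x => chi x * psi x)).
apply: eq_bigr => a _; rewrite mulr_sumr; apply: eq_bigr => x /cyc_classP[k ->].
by rewrite mul_char_exp // exprD exprM mul_char_unity_root expr1n mulr1.
Qed.

Lemma nontrivial_char_gamma : nontrivial_char chi -> chi gamma != 1.
Proof.
case=> x [/exp_gammaP[l ->]]; rewrite mul_char_exp //.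
by apply: contra => /eqP->; rewrite expr1n.
Qed.

Lemma sum_mul_char_exp : nontrivial_char chi -> \sum_(a < N) chi gamma ^+ a = 0.
Proof.
move=> /nontrivial_char_gamma chi1; have := subrX1 (chi gamma) N.
rewrite mul_char_unity_root subrr => /esym/eqP.
by rewrite mulf_eq0 subr_eq0 (negPf chi1) => /eqP.
Qed.

End TrivialOnC0.

Lemma mul_char_exists (z : algC) : z ^+ N = 1 ->
  exists chi : F -> algC, [/\ is_mul_char chi,
    forall x, x \in C0 gamma N -> chi x = 1 & chi gamma = z].
Proof.
move=> zN.
(* The character is [z] raised to the discrete logarithm of [x]; the default exponent only serves
   [x = 0], where the value is irrelevant. *)
pose chi (x : F) := z ^+ odflt 0%N
  (omap val [pick l : 'I_(#|F| - 1) | gamma ^+ l == x]).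
have q1 := prim_order_gt0 gamma_prim.
have chiE l : chi (gamma ^+ l) = z ^+ l.
  have zmod i j : (i = j %[mod #|F| - 1])%N -> z ^+ i = z ^+ j.
    move=> ij; rewrite -(expr_mod i zN) -(expr_mod j zN).
    by rewrite -(modn_dvdm i N_dvd) ij modn_dvdm.
  rewrite /chi; case: pickP => [i|none] /=.
    by rewrite (eq_prim_root_expr gamma_prim) => /eqP; apply: zmod.
  have := none (Ordinal (ltn_pmod l q1)).
  by rewrite /= (eq_prim_root_expr gamma_prim) modn_mod eqxx.
exists chi; split; last exact: (chiE 1%N).
  split=> [|_ _ /exp_gammaP[i ->] /exp_gammaP[j ->]].
    exact: (chiE 0%N).
  by rewrite -exprD !chiE exprD.
by move=> _ /imsetP[k _ ->]; rewrite -exprM chiE exprM zN expr1n.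
Qed.

Lemma dvdA_mull (e x y : algC) : x \in Aint -> (e %| y)%A -> (e %| x * y)%A.
Proof.
rewrite ![(e %| _)%A]unfold_in; case: ifP => [_ _ /eqP->|_ xA yA]; first by rewrite mulr0.
by rewrite -mulrA rpredM.
Qed.

(* Fourier inversion on Z/N: N eta_a + 1 is the sum of chi^-1(gamma^a) G(chi) over the
   nontrivial chi. *)
Lemma dvdA_period (t : algC) (a : nat) :
  (forall chi : F -> algC, is_mul_char chi -> nontrivial_char chi ->
     (forall x, x \in C0 gamma N -> chi x = 1) -> (t %| gauss_sum p f xi chi)%A) ->
  (t %| N%:R * eta a + 1)%A.
Proof.
move=> t_dvd; have [z z_prim] := C_prim_root_exists N_gt0.
have zN := prim_expr_order z_prim.
(* The exponent [N.-1 * a] represents [- a] modulo [N]. *)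
have inv : N%:R * eta a =
    \sum_(j < N) z ^+ (j * (N.-1 * a))%N * \sum_(b < N) (z ^+ j) ^+ b * eta b.
  under eq_bigr do rewrite mulr_sumr.
  rewrite exchange_big /= (bigD1 (Ordinal (ltn_pmod a N_gt0))) //=.
  rewrite [X in _ + X]big1 ?addr0 => [|b]; last first.
    rewrite -val_eqE /= => ba.
    under eq_bigr do rewrite mulrA -exprM -exprD -mulnDr mulnC exprM.
    rewrite -mulr_suml; set y := z ^+ _.
    have y1 : y != 1.
      rewrite /y -(expr0 z) (eq_prim_root_expr z_prim) mod0n.
      apply: contra ba => dvd.
      rewrite -(modn_small (ltn_ord b)) -(eqn_modDl (N.-1 * a)%N) (eqP dvd).
      by rewrite [(_ + a)%N]addnC -mulSn prednK // modnMr.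
    have := subrX1 y N; rewrite /y -exprM mulnC exprM zN expr1n subrr -/y.
    by move/esym/eqP; rewrite mulf_eq0 subr_eq0 (negPf y1) => /eqP->; rewrite mul0r.
  rewrite (eq_bigr (fun=> eta a)) ?sumr_const ?card_ord ?mulr_natl // => j _.
  rewrite (gauss_period_mod (modn_mod a N)) mulrA -exprM -exprD -mulnDr.
  rewrite mulnC exprM -(expr_mod _ zN) modnDmr addnC -mulSn prednK // modnMr.
  by rewrite expr0 expr1n mul1r.
(* The term [j = 0] is the sum of all periods, -1, and cancels the added 1. *)
rewrite inv (bigD1 (Ordinal N_gt0)) //= mul0n expr0 mul1r.
under eq_bigr do rewrite expr1n mul1r.
rewrite sum_gauss_period addrAC addNr add0r; apply: rpred_sum => j j0.
have [chi [chi_mul chi_C0 chi_gamma]] : exists chi : F -> algC, [/\ is_mul_char chi,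
    forall x, x \in C0 gamma N -> chi x = 1 & chi gamma = z ^+ j].
  by apply: mul_char_exists; rewrite -exprM mulnC exprM zN expr1n.
rewrite -chi_gamma -gauss_sum_periods //; apply: dvdA_mull.
  by rewrite rpredX // (Aint_prim_root z_prim).
apply: t_dvd => //; exists gamma; rewrite gamma_neq0; split=> //.
rewrite chi_gamma -(expr0 z) (eq_prim_root_expr z_prim) mod0n modn_small //.
Qed.

(** * Normalized periods and their moments *)

Let t (k : nat) : int := (p ^ k)%N%:Z.

(** With [x] the quotient of [N * eta a + 1] by [t k], the congruence on [w] gives that [N] divides
    [t k * (x - w)]. As [t k] is prime to [N], one may take [y a = (x - w) / N]. *)
Lemma normalized_periods (k : nat) (w : int) :
  coprime p.-1 N ->
  (forall chi : F -> algC, is_mul_char chi -> nontrivial_char chi ->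
     (forall x, x \in C0 gamma N -> chi x = 1) ->
     ((p ^ k)%N%:R %| gauss_sum p f xi chi)%A) ->
  (N%:Z %| t k * - w + 1)%Z ->
  exists (y : nat -> int) (c : int),
    (forall a, eta a = (t k * y a + c)%:~R) /\ N%:Z * c = t k * w - 1.
Proof.
move=> co_p1N t_dvd /dvdzP[c cE].
have t0 : t k != 0 by rewrite /t eqz_nat expn_eq0 negb_and -lt0n prime_gt0.
have t0C : (p ^ k)%N%:R != 0 :> algC
  by rewrite pnatr_eq0 expn_eq0 negb_and -lt0n prime_gt0.
have co_tN : coprimez N%:Z (t k).
  by rewrite /t coprimezE /= coprime_sym coprimeXl // coprime_char_N.
pose e a : int := Num.floor (eta a).
have eE a : eta a = (e a)%:~R by rewrite floorK // gauss_period_int.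
have t_e a : (t k %| N%:Z * e a + 1)%Z.
  (* Divisibility among algebraic integers descends to the integers because the quotient is
     rational. *)
  have := dvdA_period a t_dvd; rewrite [(_ %| _)%A]unfold_in (negPf t0C) eE /= => dvd_e.
  have : (N%:R * (e a)%:~R + 1 : algC) / (p ^ k)%N%:R \in Num.int.
    apply: Cint_rat_Aint; last exact: dvd_e.
    apply: rpred_div; last exact: rpred_nat.
    by rewrite rpredD ?rpred1 // rpredM ?rpred_nat // rpred_int.
  case/intrP => x xE; apply/dvdzP; exists x; apply: (@intr_inj algC).
  by rewrite rmorphM /= -xE divfK // rmorphD rmorphM.
have N_e a : (N%:Z %| ((N%:Z * e a + 1) %/ t k)%Z - w)%Z.
  rewrite -(Gauss_dvdzr _ co_tN) mulrBr [t k * (_ %/ _)%Z]mulrC divzK //.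
  have -> : N%:Z * e a + 1 - t k * w = (e a + c) * N%:Z by rewrite mulrDl -cE; ring.
  exact: dvdz_mull.
exists (fun a => ((((N%:Z * e a + 1) %/ t k)%Z - w) %/ N)%Z), (- c); split; last first.
  by rewrite mulrN mulrC -cE; ring.
move=> a; rewrite eE; congr (_%:~R).
have NZ : N%:Z != 0 by rewrite eqz_nat -lt0n.
apply: (mulfI NZ); rewrite mulrDr mulrCA [N%:Z * (_ %/ _)%Z]mulrC divzK //.
rewrite mulrBr [t k * (_ %/ _)%Z]mulrC divzK // mulrN [N%:Z * c]mulrC -cE; ring.
Qed.

Section NormalizedPeriods.

Variables (k : nat) (w c : int) (y : nat -> int).
Hypothesis co_p1N : coprime p.-1 N.
Hypotheses (etaE : forall a, eta a = (t k * y a + c)%:~R) (cE : N%:Z * c = t k * w - 1).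

Let t_neq0 : t k != 0.
Proof. by rewrite /t eqz_nat expn_eq0 negb_and -lt0n prime_gt0. Qed.

Let N_neq0 : N%:Z != 0.
Proof. by rewrite eqz_nat -lt0n. Qed.

Lemma normalized_period_inj a b : eta a = eta b -> y a = y b.
Proof.
by rewrite !etaE => /(@intr_inj algC) /addIr; apply: mulfI.
Qed.

Lemma sum_normalized_period : \sum_(a < N) y a = - w.
Proof.
apply: (mulfI t_neq0); have := sum_gauss_period.
under eq_bigr do rewrite etaE; rewrite -rmorph_sum /= big_split /= -mulr_sumr.
rewrite sumr_const card_ord -mulr_natl natz cE => tE.
have {}tE : t k * (\sum_(a < N) y a) + (t k * w - 1) = -1.
  by apply: (@intr_inj algC); rewrite tE.
by apply: (addIr (t k * w - 1)); rewrite tE; ring.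
Qed.

Lemma sum_normalized_period_shift : \sum_(a < N) y a.+1 = - w.
Proof.
rewrite -sum_normalized_period.
have yN : y N = y 0%N.
  by apply: normalized_period_inj; apply: gauss_period_mod; rewrite modnn mod0n.
apply: (addrI (y 0%N)); rewrite [RHS]addrC -{2}yN.
by transitivity (\sum_(a < N.+1) y a); [rewrite big_ord_recl|rewrite big_ord_recr].
Qed.

Lemma normalized_period_correlation b :
  \sum_(a < N) (t k * y a + c) * (t k * y (a + b) + c) =
    (if (N %| b)%N then #|F| else 0)%:Z - #|C 0|%:Z.
Proof.
apply: (@intr_inj algC); rewrite rmorph_sum rmorphB /= -gauss_period_correlation //.
by apply: eq_bigr => a _; rewrite !etaE rmorphM.
Qed.

(** This is the correlation at shift 0, multiplied by [N] so that [c] enters only through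
    [N * c = t k * w - 1]. The right side is that of condition (ii). *)
Lemma sum_sqr_normalized_period :
  N%:Z * t k ^+ 2 * \sum_(a < N) y a ^+ 2 = (N%:Z - 1) * #|F|%:Z + t k ^+ 2 * w ^+ 2.
Proof.
have := normalized_period_correlation 0; rewrite dvdn0.
under eq_bigr do rewrite addn0.
have -> : \sum_(a < N) (t k * y a + c) * (t k * y a + c) =
    t k ^+ 2 * \sum_(a < N) y a ^+ 2 + 2 * t k * c * \sum_(a < N) y a + N%:Z * c ^+ 2.
  have -> : N%:Z * c ^+ 2 = \sum_(a < N) c ^+ 2.
    by rewrite sumr_const card_ord -mulr_natl natz.
  rewrite !mulr_sumr -!big_split; apply: eq_bigr => a _ /=; ring.
rewrite sum_normalized_period.
have /(congr1 Posz) := card_cyc_class0.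
rewrite PoszM -subzn ?(ltnW (finNzRing_gt1 F)) // => KE sqE.
set S := \sum_(a < N) _ in sqE *; set q := #|F|%:Z in KE sqE *.
have {}sqE : N%:Z * (t k ^+ 2 * S + 2 * t k * c * - w + N%:Z * c ^+ 2) =
    N%:Z * q - (q - 1) by rewrite sqE mulrBr KE.
have NcE : N%:Z * (N%:Z * c ^+ 2 + 2 * t k * c * - w) =
   (t k * w - 1) ^+ 2 - 2 * t k * w * (t k * w - 1) by rewrite -cE; ring.
have -> : N%:Z * t k ^+ 2 * S = (N%:Z * (t k ^+ 2 * S + 2 * t k * c * - w + N%:Z * c ^+ 2))
   - N%:Z * (N%:Z * c ^+ 2 + 2 * t k * c * - w) by ring.
rewrite sqE NcE; ring.
Qed.

(** In the difference of the correlations at shifts 0 and 1, the class sizes cancel, and so do the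
    linear terms, by cyclic invariance of the sum. *)
Lemma normalized_period_variation :
  t k ^+ 2 * \sum_(a < N) y a * (y a - y a.+1) = #|F|%:Z.
Proof.
have c0 := normalized_period_correlation 0; have c1 := normalized_period_correlation 1.
rewrite dvdn0 in c0; rewrite dvdn1 gtn_eqF ?(ltnW N_gt2) // in c1.
have -> : #|F|%:Z = (#|F|%:Z - #|C 0|%:Z) - (0%:Z - #|C 0|%:Z) by ring.
rewrite -c0 -c1 -sumrB.
under [RHS]eq_bigr do rewrite addn0 addn1.
transitivity (t k ^+ 2 * \sum_(a < N) y a * (y a - y a.+1)
   + t k * c * (\sum_(a < N) y a - \sum_(a < N) y a.+1)).
  by rewrite sum_normalized_period sum_normalized_period_shift subrr mulr0 addr0.
rewrite -sumrB !mulr_sumr -big_split; apply: eq_bigr => a _ /=; ring.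
Qed.

(** By the variation identity [d] divides [#|F|], so a non-unit [d] is a multiple of [p]. Then
    [p ^ k.+1] divides every Gauss sum, against the maximality of [k]. *)
Lemma normalized_period_primitive (d : int) :
  (forall k' : nat,
     (forall chi : F -> algC, is_mul_char chi -> nontrivial_char chi ->
        (forall x, x \in C0 gamma N -> chi x = 1) ->
        ((p ^ k')%N%:R %| gauss_sum p f xi chi)%A) -> (k' <= k)%N) ->
  (forall a : 'I_N, (d %| y a)%Z) -> `|d|%N = 1%N.
Proof.
move=> k_max d_dvd.
have y_dvd a : (d %| y a)%Z.
  have -> : y a = y (a %% N)%N.
    by apply: normalized_period_inj; apply: gauss_period_mod; rewrite modn_mod.
  exact: (d_dvd (Ordinal (ltn_pmod a N_gt0))).
have d_q : (d %| #|F|%:Z)%Z.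
  rewrite -normalized_period_variation; apply: dvdz_mull; apply: rpred_sum => a _.
  exact: dvdz_mulr.
apply/eqP; apply: contraT => d1.
have d_q' : (`|d| %| p ^ f)%N by rewrite -cardF; exact: d_q.
have /(dvdn_pfactor _ _ p_prime)[i _ dE] := d_q'.
have p_dvd a : (p%:Z %| y a)%Z.
  apply: dvdz_trans (y_dvd a); rewrite dvdzE /= dE.
  by case: i dE d1 => [->|i _ _]; rewrite ?expnS ?dvdn_mulr.
suff : (k.+1 <= k)%N by rewrite ltnn.
apply: k_max => chi chi_mul chi_nt chi_C0.
rewrite gauss_sum_periods //.
(* The constant [c] drops out because the powers of [chi gamma] sum to 0. *)
have -> : \sum_(a < N) chi gamma ^+ a * eta a =
    (\sum_(a < N) chi gamma ^+ a * (y a %/ p)%Z%:~R) * (p ^ k.+1)%N%:R.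
  transitivity (\sum_(a < N) chi gamma ^+ a * (t k * y a)%:~R
      + (\sum_(a < N) chi gamma ^+ a) * c%:~R).
    rewrite mulr_suml -big_split; apply: eq_bigr => a _ /=.
    by rewrite etaE rmorphD mulrDr.
  rewrite sum_mul_char_exp // mul0r addr0 mulr_suml; apply: eq_bigr => a _.
  rewrite -mulrA -{1}(divzK (p_dvd a)) expnS natrM !rmorphM /= mulrCA.
  by rewrite -[(t k)%:~R]/((p ^ k)%N%:R : algC) -[p%:~R]/(p%:R : algC); ring.
apply: dvdA_mull.
  apply: rpred_sum => a _; apply: rpredM; last exact: Aint_int.
  apply: rpredX; apply: (Aint_unity_root N_gt0); apply/unity_rootP.
  exact: mul_char_unity_root.
rewrite [(_ %| _)%A]unfold_in; case: ifP => // /negbT pk0.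
by rewrite divff.
Qed.

End NormalizedPeriods.

End MultiplicativeCharacters.

End AdditiveCharacter.

(** * Assembling the theorem *)

Unset Implicit Arguments.

Theorem theorem3p4 (F : finFieldType) (p f : nat) (xi : algC) (gamma : F)
    (N t u v r s : nat) :
  (p \in [pchar F]) -> #|F| = (p ^ f)%N ->
  p.-primitive_root xi ->
  (2 < N)%N -> (N %| #|F| - 1)%N ->
  (#|F| - 1)%N.-primitive_root gamma ->
  (* t is the largest power of p dividing every G_q(chi), chi nontrivial, trivial on C_0 *)
  (exists k : nat, t = (p ^ k)%N /\
     (forall chi : F -> algC, is_mul_char chi -> nontrivial_char chi ->
        (forall x, x \in C0 gamma N -> chi x = 1) ->
        (t%:R %| gauss_sum p f xi chi)%A) /\
     (forall k' : nat,
        (forall chi : F -> algC, is_mul_char chi -> nontrivial_char chi ->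
           (forall x, x \in C0 gamma N -> chi x = 1) ->
           ((p ^ k')%N%:R %| gauss_sum p f xi chi)%A) ->
        (k' <= k)%N)) ->
  (0 < u)%N -> (0 < v)%N -> (0 < r)%N -> (0 < s)%N ->
  (* (i) t(-ur+vs) = -1 (mod N) *)
  (N%:Z %| t%:Z * (- (u * r)%N%:Z + (v * s)%N%:Z) + 1)%Z ->
  (* (ii) (N-1)q + t^2(-ur+vs)^2 = N t^2 (u^2 r + v^2 s) *)
  (N%:Z - 1) * #|F|%:Z + t%:Z ^+ 2 * (- (u * r)%N%:Z + (v * s)%N%:Z) ^+ 2
    = N%:Z * t%:Z ^+ 2 * ((u ^ 2 * r)%N%:Z + (v ^ 2 * s)%N%:Z) ->
  (2 <= gcd_ords N p)%N ->
  let m := gcd_ords N p in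
     [/\ u = 1%N, s = 1%N, (v * (v + 1) < 2 * m)%N & (r + 1 < N)%N] \/
      [/\ u = 1%N, s = 1%N, (v * (v + 1) = 2 * m)%N & (r + v ^ 2 < N)%N] \/
      [/\ v = 1%N, r = 1%N, (u * (u + 1) < 2 * m)%N & (s + 1 < N)%N] \/
      [/\ v = 1%N, r = 1%N, (u * (u + 1) = 2 * m)%N & (s + u ^ 2 < N)%N] \/
      [/\ u = 1%N, v = 1%N, s = m & (r + m < N)%N] \/
      [/\ u = 1%N, v = 1%N, r = m & (s + m < N)%N] ->
  size (undup [seq gauss_period p f xi gamma N a | a <- iota 0 N]) = 3%N.
Proof.
move=> pF cardF xi_prim N_gt2 N_dvd gamma_prim [k [tE [t_dvd k_max]]].
move=> u0 v0 r0 s0 hi hii m2 m cases; subst t.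
have p_prime := pcharf_prime pF.
have N_gt0 : (0 < N)%N := ltnW (ltnW N_gt2).
have co_p1N := gcd_ords_coprime N_gt0 (prime_gt0 p_prime) m2.
have co_pN := coprime_char_N cardF N_dvd.
set w := - _ + _ in hi hii.
(* The normalization is applied to [- w], so that the values [y a] sum to [w]. *)
have hw : (N%:Z %| (p ^ k)%N%:Z * - (- w) + 1)%Z by rewrite opprK.
have [y [c [etaE cE]]] :=
  normalized_periods pF cardF xi_prim N_gt2 N_dvd gamma_prim co_p1N t_dvd hw.
have y_inj := normalized_period_inj pF etaE.
have sum_y := sum_normalized_period pF cardF xi_prim N_gt2 N_dvd gamma_prim etaE cE.
have sum_y2 :=
  sum_sqr_normalized_period pF cardF xi_prim N_gt2 N_dvd gamma_prim co_p1N etaE cE.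
have y_prim d := @normalized_period_primitive _ _ _ _ pF cardF xi_prim _ _
  N_gt2 N_dvd gamma_prim _ _ _ _ co_p1N etaE cE d k_max.
have t_neq0 : (p ^ k)%N%:Z != 0 by rewrite eqz_nat expn_eq0 negb_and -lt0n prime_gt0.
pose T := 'I_N; pose i0 : T := Ordinal N_gt0.
(* A fibre of [y] is stable under multiplication by [p], and so is the set of nonzero indices, since
   [p] is invertible modulo [N]. *)
have m_dvd z : (m %| #|[set a : T | (a != i0) && (y a == z)]|)%N.
  apply: gcd_ords_dvd_card => // [a|a b ba]; rewrite !inE => /andP[a0 ya].
    by move: a0; rewrite -val_eqE.
  have <- : y a = y b.
    apply: y_inj; rewrite -(gauss_period_frobenius pF cardF xi_prim N_gt2 N_dvd gamma_prim).
    exact/esym/(gauss_period_mod p f xi N_gt2 N_dvd gamma_prim).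
  rewrite ya andbT; apply: contra a0 => /eqP b0; move: ba.
  rewrite b0 mod0n => /esym/eqP; rewrite -/(dvdn N _) Gauss_dvdr 1?coprime_sym //.
  by rewrite /dvdn modn_small // -val_eqE.
have {}sum_y : \sum_(a < N) y a = - (u * r)%N%:Z + (v * s)%N%:Z by rewrite sum_y opprK.
have {}sum_y2 : \sum_(a < N) y a ^+ 2 = (u ^ 2 * r)%N%:Z + (v ^ 2 * s)%N%:Z.
  apply: (@mulfI _ (N%:Z * (p ^ k)%N%:Z ^+ 2)).
    by rewrite mulf_neq0 ?expf_neq0 // eqz_nat -lt0n.
  by rewrite sum_y2 sqrrN hii.
have -> : size (undup [seq gauss_period p f xi gamma N a | a <- iota 0 N]) =
    size (undup [seq y a | a : T]).
  (* The periods are the image of [y] under an injective affine map, so both take equally many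
     values. *)
  pose g (z : int) : algC := ((p ^ k)%N%:Z * z + c)%:~R.
  have g_inj : injective g.
    by move=> z1 z2 /(@intr_inj algC) /addIr; apply: mulfI.
  rewrite -val_enum_ord -map_comp (eq_map (g := g \o (y \o val))); last first.
    by move=> a; rewrite /= etaE.
  by rewrite map_comp undup_map_inj // size_map.
have card_T : #|T| = N by rewrite card_ord.
have y_case : [\/ [/\ u = 1%N, s = 1%N, (v * (v + 1) < 2 * m)%N & (r + 1 < #|T|)%N],
      [/\ u = 1%N, s = 1%N, (v * (v + 1) = 2 * m)%N & (r + v ^ 2 < #|T|)%N] |
      [/\ u = 1%N, v = 1%N, s = m & (r + m < #|T|)%N] ] \/
    [\/ [/\ v = 1%N, r = 1%N, (u * (u + 1) < 2 * m)%N & (s + 1 < #|T|)%N],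
      [/\ v = 1%N, r = 1%N, (u * (u + 1) = 2 * m)%N & (s + u ^ 2 < #|T|)%N] |
      [/\ v = 1%N, u = 1%N, r = m & (s + m < #|T|)%N] ].
  rewrite card_T; case: cases => [H|[H|[H|[H|[H|[? ? ? ?]]]]]].
  - by left; apply: Or31.
  - by left; apply: Or32.
  - by right; apply: Or31.
  - by right; apply: Or32.
  - by left; apply: Or33.
  - by right; apply: Or33.
case: y_case => y_case.
  exact: (three_values m2 v0 r0 m_dvd y_prim sum_y sum_y2 y_case).
(* Negation keeps the number of values and exchanges the roles of [u], [r] and [v], [s]. *)
have <- : size (undup [seq - y a | a : T]) = size (undup [seq y a | a : T]).
  rewrite (_ : [seq - y a | a : T] = map -%R [seq y a | a : T]); last by rewrite -map_comp.
  by rewrite (undup_map_inj oppr_inj) size_map.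
apply: (three_values (i0 := i0) (y := fun a : T => - y a) m2 u0 s0 _ _ _ _ y_case).
- move=> z; have := m_dvd (- z); congr (_ %| _)%N; apply: eq_card => a.
  by rewrite !inE -eqr_oppLR.
- by move=> d dy; apply: y_prim => a; have := dy a; rewrite !dvdzE abszN.
- by rewrite sumrN sum_y; ring.
- by under eq_bigr do rewrite sqrrN; rewrite sum_y2 addrC.
Qed.
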